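(* Let $n,m\ge1$ be integers and let $T\in B(\mathcal H)$ be Drazin invertible. Then $T\in[(n,m)DQN]$ if and only if $T\in[(n,m)DN]$; that is, $[T_d^n,T^{*m}T]=0$ if and only if $[T_d^n,T^{*m}]=0$.
   Context: $\mathcal H$ is a complex infinite dimensional Hilbert space and $B(\mathcal H)$ is the algebra of bounded linear operators on $\mathcal H$; $[X,Y]=XY-YX$ and $T^{*m}=(T^* )^m$. An operator $T\in B(\mathcal H)$ is Drazin invertible if there is $T_d\in B(\mathcal H)$ (the Drazin inverse) with $[T_d,T]=0$, $T_d^2T=T_d$ and $T^{p+1}T_d=T^p$ for some integer $p\ge1$ (if $T$ is invertible, $T_d=T^{-1}$). For a Drazin invertible $T$: $T\in[(n,m)DN]$ ($(n,m)$-power D-normal) means $[T_d^n,T^{*m}]=0$; $T\in[(n,m)DQN]$ ($(n,m)$-power D-quasinormal) means $[T_d^n,T^{*m}T]=0$. *)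

(* Defs.v *)
From HB Require Import structures.
From mathcomp Require Import all_boot all_order all_algebra.
From mathcomp Require Import complex ring.
From mathcomp Require Import boolp classical_sets functions.
From mathcomp Require Import interval_inference reals topology normedtype.

Set Implicit Arguments.
Unset Strict Implicit.
Unset Printing Implicit Defensive.
Import Order.TTheory GRing.Theory Num.Theory numFieldNormedType.Exports.
Local Open Scope classical_set_scope.
Local Open Scope ring_scope.

(* The inner product is linear in its first argument and conjugate-linear in
   the second, which is the convention of {dot H for Num.conj}. *)
HB.mixin Record isHilbert (R : realType) (H : Type)
    of CompleteNormedModule R[i] H := {
  inner : {dot H for Num.conj};
  sqr_norm_inner : forall x : H, `|x| ^+ 2 = inner x x }.

#[short(type="hilbertType")]
HB.structure Definition Hilbert (R : realType) :=
  {H of isHilbert R H & CompleteNormedModule R[i] H}.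

Definition infinite_dimensional (R : realType) (H : hilbertType R) :=
  forall n (e : 'I_n -> H), exists x : H,
    forall c : 'I_n -> R[i], x <> \sum_i c i *: e i.

Definition bounded_linear (R : realType) (H : hilbertType R) : {pred H -> H} :=
  fun T => `[< linear T /\ exists M : R[i], forall x, `|T x| <= M * `|x| >].

Record boundedOp (R : realType) (H : hilbertType R) := BOp {
  bop_fun :> H -> H;
  bop_subproof : bop_fun \in @bounded_linear R H }.

Section BoundedOperators.
Variables (R : realType) (H : hilbertType R).
Implicit Types S T : boundedOp H.

Lemma bounded_linear_bound (T : H -> H) (M : R[i]) :
  (forall x, `|T x| <= M * `|x|) ->
  exists2 N : R[i], 0 <= N & forall x, `|T x| <= N * `|x|.
Proof.
move=> TM; exists `|M| => // x; rewrite (le_trans (TM x)) //.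
have := le_trans (normr_ge0 _) (TM x).
have [->|x0] := eqVneq x 0; first by rewrite normr0 !mulr0.
by rewrite pmulr_lge0 ?normr_gt0// => M0; rewrite ger0_norm.
Qed.

Fact bounded_linear_zmod_closed : zmod_closed (@bounded_linear R H).
Proof.
split=> [|f g /asboolP[lf [M fM]] /asboolP[lg [N gN]]]; apply/asboolP; split.
- by move=> a x y; rewrite scaler0 addr0.
- by exists 0 => x; rewrite normr0 mul0r.
- move=> a x y; have fgE z : (f - g) z = f z - g z by [].
  by rewrite !fgE lf lg scalerBr opprD addrACA.
- exists (M + N) => x; rewrite mulrDl (le_trans (ler_normB _ _))//.
  exact: lerD.
Qed.

HB.instance Definition _ :=
  GRing.isZmodClosed.Build (H -> H) (@bounded_linear R H) bounded_linear_zmod_closed.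
HB.instance Definition _ := [isSub for @bop_fun R H].
HB.instance Definition _ := [Choice of boundedOp H by <:].
HB.instance Definition _ := [SubChoice_isSubZmodule of boundedOp H by <:].

Lemma bop_linear T : linear T.
Proof. by have /asboolP[] := valP T. Qed.

HB.instance Definition _ T :=
  GRing.isLinear.Build R[i] H H *:%R (T : H -> H) (bop_linear T).

Lemma bop_bounded T : exists2 M : R[i], 0 <= M & forall x, `|T x| <= M * `|x|.
Proof. by have /asboolP[_ [M /bounded_linear_bound]] := valP T. Qed.

Lemma bopP S T : (forall x, S x = T x) -> S = T.
Proof. by move=> ST; apply/val_inj/funext. Qed.

Fact bop_id_subproof : (fun x => x) \in @bounded_linear R H.
Proof. by apply/asboolP; split=> //; exists 1 => x; rewrite mul1r. Qed.

Fact bop_comp_subproof S T : (fun x => S (T x)) \in @bounded_linear R H.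
Proof.
apply/asboolP; split; first by move=> a x y; rewrite !linearP.
have [M M0 SM] := bop_bounded S; have [N N0 TN] := bop_bounded T.
by exists (M * N) => x; rewrite (le_trans (SM _))// -mulrA ler_wpM2l.
Qed.

Definition bop_id : boundedOp H := BOp bop_id_subproof.
Definition bop_comp S T : boundedOp H := BOp (bop_comp_subproof S T).

Fact bop_compA : associative bop_comp. Proof. by move=> *; apply: bopP. Qed.
Fact bop_comp1l : left_id bop_id bop_comp. Proof. by move=> *; apply: bopP. Qed.
Fact bop_comp1r : right_id bop_id bop_comp. Proof. by move=> *; apply: bopP. Qed.
Fact bop_compDl : left_distributive bop_comp +%R.
Proof. by move=> *; apply: bopP. Qed.
Fact bop_compDr : right_distributive bop_comp +%R.
Proof. by move=> S T U; apply: bopP => x /=; rewrite linearD. Qed.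

(* The ring product is composition, so that T ^+ n is the n-th iterate; H may
   be trivial, hence the possibly zero ring. *)
HB.instance Definition _ := GRing.Zmodule_isPzRing.Build (boundedOp H)
  bop_compA bop_comp1l bop_comp1r bop_compDl bop_compDr.

Lemma bop0E x : (0 : boundedOp H) x = 0. Proof. by []. Qed.
Lemma bop1E x : (1 : boundedOp H) x = x. Proof. by []. Qed.
Lemma bopDE S T x : (S + T) x = S x + T x. Proof. by []. Qed.
Lemma bopNE T x : (- T) x = - T x. Proof. by []. Qed.
Lemma bopME S T x : (S * T) x = S (T x). Proof. by []. Qed.
Lemma bopXE T n x : (T ^+ n) x = iter n T x.
Proof. by elim: n => //= n IHn; rewrite exprS bopME IHn. Qed.

End BoundedOperators.

Section Riesz.
Variables (R : realType) (H : hilbertType R).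
Implicit Types x y z : H.
Local Notation "'[ x , y ]" := (inner x y).

Lemma innerC x y : '[x, y] = '[y, x]^*.
Proof. by rewrite hermC /= expr0 mul1r. Qed.

Lemma innerBl x y z : '[x - y, z] = '[x, z] - '[y, z].
Proof. exact: linearBl. Qed.
Lemma innerBr x y z : '[x, y - z] = '[x, y] - '[x, z].
Proof. exact: linearBr. Qed.
Lemma innerDl x y z : '[x + y, z] = '[x, z] + '[y, z].
Proof. exact: linearDl. Qed.
Lemma innerDr x y z : '[x, y + z] = '[x, y] + '[x, z].
Proof. exact: linearDr. Qed.
Lemma innerZl a x y : '[a *: x, y] = a * '[x, y].
Proof. exact: linearZl_LR. Qed.
Lemma innerZr a x y : '[x, a *: y] = a^* * '[x, y].
Proof. exact: linearZr_LR. Qed.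

Lemma inner_inj y z : (forall x, '[x, y] = '[x, z]) -> y = z.
Proof.
move=> yz; apply/eqP; rewrite -subr_eq0 -normr_eq0 -sqrf_eq0.
by rewrite sqr_norm_inner innerBr yz subrr.
Qed.

Lemma parallelogram x y :
  `|x + y| ^+ 2 + `|x - y| ^+ 2 = `|x| ^+ 2 *+ 2 + `|y| ^+ 2 *+ 2.
Proof.
rewrite !sqr_norm_inner !(innerBl, innerBr, innerDl, innerDr).
set a := '[x, x]; set b := '[y, x]; set c := '[x, y]; set d := '[y, y].
by ring.
Qed.

Lemma sqr_norm_proj x y : y != 0 ->
  `|x - ('[x, y] / `|y| ^+ 2) *: y| ^+ 2
    = `|x| ^+ 2 - (`|'[x, y]| / `|y|) ^+ 2.
Proof.
move=> y0; have ny0 : `|y| != 0 by rewrite normr_eq0.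
rewrite sqr_norm_inner !(innerBl, innerBr, innerZl, innerZr) -!sqr_norm_inner.
rewrite expr_div_n [`|'[x, y]| ^+ 2]normCK (innerC y x) rmorphM/= fmorphV/=.
rewrite rmorphXn/= (CrealP (normr_real y)).
by field.
Qed.

Lemma inner_CauchySchwarz x y : `|'[x, y]| <= `|x| * `|y|.
Proof.
have [->|y0] := eqVneq y 0; first by rewrite linear0r !normr0 mulr0.
rewrite -ler_pdivrMr ?normr_gt0// -(@ler_pXn2r _ 2) ?nnegrE ?divr_ge0//.
by rewrite -subr_ge0 -sqr_norm_proj// exprn_ge0.
Qed.

Section Functional.
Variables (f : {scalar H}) (M : R[i]).
Hypothesis fM : forall x, `|f x| <= M * `|x|.

Lemma near_minimizer (x0 : H) (e : R[i]) : f x0 = 1 -> 0 < e ->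
  exists2 u, f u = 1 & forall v, f v = 1 -> `|u| ^+ 2 <= `|v| ^+ 2 + e.
Proof.
move=> fx0 e0.
have nge0 x : 0 <= `|x| ^+ 2 by rewrite exprn_ge0.
pose S := [set complex.Re (`|x| ^+ 2) | x in [set x | f x = 1]]%classic.
have Slb : lbound S 0 by move=> _ [x _ <-]; have := nge0 x; rewrite lecE => /andP[].
have infS : has_inf S by split; [exists (complex.Re (`|x0| ^+ 2)), x0 | exists 0].
move: (e0); rewrite ltcE /= => /andP[/eqP Ie Re0].
have [_ [u fu <-] ule] := inf_adherent Re0 infS.
exists u => // v fv.
have vS : inf S <= complex.Re (`|v| ^+ 2).
  by apply: ge_inf; [exists 0 | exists v].
have := nge0 u; have := nge0 v; rewrite !lecE !raddfD /=.
move=> /andP[/eqP -> _] /andP[/eqP -> _]; rewrite Ie addr0 eqxx /=.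
by rewrite (le_trans (ltW ule))// lerD2r.
Qed.

Lemma exists_invS_lt (e : R[i]) : 0 < e ->
  exists n, forall m, (n <= m)%N -> ((m.+1%:R^-1 : R)%:C)%C < e.
Proof.
rewrite ltcE /= => /andP[/eqP Ie Re0].
have [N _ Nlt] := near_infty_natSinv_lt (PosNum Re0).
by exists N => m Nm; rewrite ltcE/= Ie eqxx/=; apply: Nlt.
Qed.

Lemma riesz_representation : exists z, forall x, f x = '[x, z].
Proof.
have [M0 M_ge0 fM0] : exists2 N : R[i], 0 <= N & forall x, `|f x| <= N * `|x|.
  exists `|M| => // x; rewrite (le_trans (fM x)) //.
  have := le_trans (normr_ge0 _) (fM x).
  have [->|x0] := eqVneq x 0; first by rewrite normr0 !mulr0.
  by rewrite pmulr_lge0 ?normr_gt0// => N0; rewrite ger0_norm.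
have [f0|] := pselect (forall x, f x = 0).
  by exists 0 => x; rewrite f0 linear0r.
move=> /existsNP[x1 /eqP fx1]; pose x0 := (f x1)^-1 *: x1.
have fx0 : f x0 = 1 by rewrite linearZ /= mulVf.
pose eps n : R[i] := ((n.+1%:R^-1 : R)%:C)%C.
have eps_gt0 n : 0 < eps n by rewrite ltcE /= eqxx /= invr_gt0 ltr0n.
have eps_ge0 n : 0 <= eps n by exact: ltW.
have eps_le n m : (n <= m)%N -> eps m <= eps n.
  by move=> nm; rewrite lecE /= eqxx /= lef_pV2 ?posrE ?ltr0n// ler_nat.
have /choice[u ufu] n : exists u, f u = 1 /\
    forall v, f v = 1 -> `|u| ^+ 2 <= `|v| ^+ 2 + eps n ^+ 2.
  have [|v] := @near_minimizer x0 (eps n ^+ 2) fx0; last by exists v.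
  by rewrite exprn_gt0.
have fu n : f (u n) = 1 by have [] := ufu n.
have umin n v : f v = 1 -> `|u n| ^+ 2 <= `|v| ^+ 2 + eps n ^+ 2.
  by have [_] := ufu n; apply.
have u_dist n m : (n <= m)%N -> `|u n - u m| <= 2 * eps n.
  move=> nm; rewrite -(@ler_pXn2r _ 2) ?nnegrE ?mulr_ge0//.
  pose v := 2^-1 *: (u n + u m).
  have fv : f v = 1 by rewrite linearZ linearD /= !fu -mulr2n mulVf// pnatr_eq0.
  have uv : u n + u m = 2 *: v by rewrite scalerA mulfV ?scale1r// pnatr_eq0.
  have := parallelogram (u n) (u m).
  rewrite uv normrZ normr_nat exprMn => /(canRL (addKr _)) ->.
  have le1 := umin n v fv; have le2 := umin m v fv.
  have le3 : eps m ^+ 2 <= eps n ^+ 2 by rewrite ler_pXn2r ?nnegrE// eps_le.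
  rewrite addrC lerBlDr exprMn.
  apply: (@le_trans _ _ ((`|v| ^+ 2 + eps n ^+ 2) *+ 2 + (`|v| ^+ 2 + eps n ^+ 2) *+ 2)).
    by apply: lerD; rewrite lerMn2r//= (le_trans le2)// lerD2l.
  by rewrite le_eqVlt; apply/orP; left; apply/eqP; ring.
have : cauchy (u @ \oo).
  apply: cauchy_exP => e e0.
  have [|n ne] := @exists_invS_lt (e / 2); first by rewrite divr_gt0.
  exists (u n); exists n => // m /= nm; rewrite -ball_normE /=.
  rewrite (le_lt_trans (u_dist n m nm))// mulrC -ltr_pdivlMr//.
  exact: ne.
move=> /cauchy_cvg /cvg_ex[w uw].
have uwlt (e : R[i]) : 0 < e -> exists n, `|w - u n| < e /\ eps n < e.
  move=> e0; have [N _ Ne] := (cvgrPdist_lt _ _).1 uw _ e0.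
  have [n ne] := exists_invS_lt e0; exists (maxn n N).
  by split; [apply: Ne; rewrite /= leq_maxr | apply: ne; rewrite leq_maxl].
have small (z C : R[i]) : 0 <= C -> (forall e, 0 < e -> `|z| <= C * e) -> z = 0.
  move=> C0 zC; apply/eqP; rewrite -normr_eq0; apply/negPn/negP => z0.
  have zp : 0 < `|z| by rewrite lt_def z0 normr_ge0.
  have C1 : 0 < C + 1 by rewrite ltr_wpDl.
  have := zC (`|z| / (C + 1)); rewrite divr_gt0// => /(_ isT).
  rewrite mulrCA -[leLHS]mulr1 ler_pM2l// ler_pdivlMr// mul1r.
  by rewrite -subr_ge0 opprD addNKr oppr_ge0 lt_geF.
have fw : f w = 1.
  apply/eqP; rewrite -subr_eq0; apply/eqP/(small _ M0) => // e e0.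
  have [n [/ltW wn _]] := uwlt e e0.
  rewrite -(fu n) -linearB (le_trans (fM0 _))//.
  exact: ler_wpM2l.
have wk k : f k = 0 -> '[w, k] = 0.
  move=> fk; have [->|k0] := eqVneq k 0; first by rewrite linear0r.
  apply: (small _ (`|k| *+ 2)) => [|e e0]; first by rewrite mulrn_wge0.
  have [n [/ltW wn /ltW en]] := uwlt e e0.
  rewrite -[w](subrK (u n)) innerDl (le_trans (ler_normD _ _))//.
  rewrite mulrnAl mulr2n lerD//.
    by rewrite (le_trans (inner_CauchySchwarz _ _))// mulrC ler_wpM2l.
  have := umin n (u n - ('[u n, k] / `|k| ^+ 2) *: k).
  rewrite linearB linearZ /= fk mulr0 subr0 fu => /(_ erefl).
  rewrite sqr_norm_proj// -addrA lerDl [- _ + _]addrC subr_ge0.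
  rewrite ler_pXn2r ?nnegrE ?divr_ge0// ler_pdivrMr ?normr_gt0// => ule.
  by rewrite (le_trans ule)// mulrC ler_wpM2l.
have w0 : '[w, w] != 0.
  rewrite -sqr_norm_inner sqrf_eq0 normr_eq0; apply/eqP => w0.
  by move: fw; rewrite w0 linear0 => /esym/eqP; rewrite oner_eq0.
exists (('[w, w]^-1)^* *: w) => x; rewrite innerZr conjCK.
have : '[w, x - f x *: w] = 0.
  by apply: wk; rewrite linearB linearZ /= fw mulr1 subrr.
rewrite innerC => /(congr1 Num.conj); rewrite conjCK conjC0 innerBl innerZl.
by move=> /eqP; rewrite subr_eq0 => /eqP ->; rewrite mulrC mulfK.
Qed.

End Functional.
End Riesz.

Section Adjoint.
Variables (R : realType) (H : hilbertType R).
Local Notation "'[ x , y ]" := (inner x y).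

Lemma adjoint_exists (T : boundedOp H) :
  exists S : boundedOp H, forall x y, '[T x, y] = '[x, S y].
Proof.
have [M M0 TM] := bop_bounded T.
have /choice[S TS] y : exists z, forall x, '[T x, y] = '[x, z].
  have lin : linear_for *%R (fun x => '[T x, y]).
    by move=> a x z; rewrite linearP innerDl innerZl.
  pose f : {scalar H} := HB.pack (fun x => '[T x, y])
    (GRing.isLinear.Build _ _ _ _ _ lin).
  apply: (@riesz_representation _ _ f (M * `|y|)) => x.
  by rewrite (le_trans (inner_CauchySchwarz _ _))// mulrAC ler_wpM2r.
have S_bl : S \in @bounded_linear R H.
  apply/asboolP; split=> [a x y|].
    apply: inner_inj => z.
    by rewrite -TS innerDr innerZr !TS innerDr innerZr.
  exists M => y; have [->|Sy0] := eqVneq (S y) 0.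
    by rewrite normr0 mulr_ge0.
  rewrite -(@ler_pM2l _ `|S y|) ?normr_gt0// -expr2 sqr_norm_inner -TS.
  rewrite -[leLHS]ger0_norm; last by rewrite TS -sqr_norm_inner exprn_ge0.
  rewrite (le_trans (inner_CauchySchwarz _ _))// mulrCA mulrA.
  by rewrite ler_wpM2r//.
by exists (BOp S_bl).
Qed.

Definition adjoint (T : boundedOp H) : boundedOp H := projT1 (cid (adjoint_exists T)).

Lemma adjointE (T : boundedOp H) x y : '[T x, y] = '[x, adjoint T y].
Proof. exact: projT2 (cid (adjoint_exists T)) x y. Qed.

Lemma adjoint_unique (T S : boundedOp H) :
  (forall x y, '[T x, y] = '[x, S y]) -> S = adjoint T.
Proof.
by move=> TS; apply: bopP => y; apply: inner_inj => x; rewrite -TS adjointE.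
Qed.

End Adjoint.

Definition commutator (A : pzRingType) (a b : A) : A := a * b - b * a.

Definition is_drazin_inverse (A : pzRingType) (a b : A) : Prop :=
  [/\ commutator b a = 0, b ^+ 2 * a = b &
      exists2 p, (1 <= p)%N & a ^+ p.+1 * b = a ^+ p].

Definition drazin_invertible (A : pzRingType) (a : A) : Prop :=
  exists b, is_drazin_inverse a b.

Lemma is_drazin_inverse_unique (A : pzRingType) (a b c : A) :
  is_drazin_inverse a b -> is_drazin_inverse a c -> b = c.
Proof.
have key k (x y : A) : GRing.comm y x -> y ^+ 2 * x = y ->
    x ^+ k.+1 * y = x ^+ k ->
    x ^+ (k + k.+1) * y ^+ k.+1 = x ^+ k /\ y ^+ k.+1 * x ^+ k = y.
  move=> yx y2x xy; split.
    suff xyj j : x ^+ (k + j) * y ^+ j = x ^+ k by exact: xyj.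
    elim: j => [|j IHj]; first by rewrite addn0 mulr1.
    rewrite exprS mulrA addnS -addSn addnC exprD -(mulrA (x ^+ j)) xy.
    by rewrite -exprD addnC.
  elim: k {xy} => [|k IHk]; first by rewrite mulr1.
  by rewrite -[k.+2]addn2 exprD [x ^+ _]exprS -mulrA [y ^+ 2 * _]mulrA y2x mulrA -exprSr.
move=> [/subr0_eq ba b2a [p _ ab]] [/subr0_eq ca c2a [q _ ac]].
have up r s y : a ^+ r.+1 * y = a ^+ r -> a ^+ (s + r).+1 * y = a ^+ (s + r).
  by move=> e; rewrite -addnS !exprD -mulrA e.
have [] := key (p + q)%N a b ba b2a; first by rewrite addnC; exact: up.
have [] := key (p + q)%N a c ca c2a; first exact: up.
set k := (p + q)%N => ack cak abk bak.
have bk : GRing.comm (b ^+ k.+1) (a ^+ (k + k.+1)).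
  exact/commrX/commr_sym/commrX/commr_sym.
have ck : GRing.comm (c ^+ k.+1) (a ^+ k).
  exact/commrX/commr_sym/commrX/commr_sym.
by rewrite -bak -ack mulrA bk abk -ck cak.
Qed.

(* Meaningful only for Drazin invertible a; the default value 0 is irrelevant
   then, see drazinP and is_drazin_inverse_unique. *)
Definition drazin (A : pzRingType) (a : A) : A :=
  xget 0 [set b | is_drazin_inverse a b].

Lemma drazinP (A : pzRingType) (a : A) :
  drazin_invertible a -> is_drazin_inverse a (drazin a).
Proof. by move=> [b ab]; rewrite /drazin; case: xgetP => [x _//|/(_ b)]. Qed.

(* (n,m)-power D-normal and (n,m)-power D-quasinormal operators. Both are meant
   for Drazin invertible T only. *)
Definition DN (R : realType) (H : hilbertType R) (n m : nat) (T : boundedOp H) : Prop :=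
  commutator (drazin T ^+ n) (adjoint T ^+ m) = 0.

Definition DQN (R : realType) (H : hilbertType R) (n m : nat) (T : boundedOp H) : Prop :=
  commutator (drazin T ^+ n) (adjoint T ^+ m * T) = 0.

(* Main.v *)
(** Put [D = drazin T] and [P = D T], an idempotent commuting with [T] and
    such that [D^n = P D^n = D^n P].  Quasinormality says that [[D^n, T*^m]]
    kills the range of [T], hence that [T*^m] and [D^n] commute on the range of
    [P], which is therefore invariant under [T*^m].  Taking adjoints, [ker P*]
    is invariant under [T^m], and thus under [T^(mp)], whose kernel is [ker P]
    and whose range is the range of [P] for [p] large.  As [ker P*] meets the
    range of [P] trivially, [T^(mp)] vanishes on [ker P*].  Thus [P] vanishes
    there too, so [P = P P*] is selfadjoint and commutes with [T*], and
    [D^n T*^m = D^n P T*^m = D^n T*^m P = T*^m D^n P = T*^m D^n]. *)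
Require Import Defs.
From mathcomp Require Import all_boot all_order all_algebra.
From mathcomp Require Import reals.
Local Open Scope ring_scope.
Import GRing.Theory Num.Theory.

Section DrazinProjection.
Context {A : pzRingType} {a b : A}.
Hypothesis ab : is_drazin_inverse a b.

Lemma drazin_comm : GRing.comm b a.
Proof. by have [/subr0_eq] := ab. Qed.

Lemma drazin_mulK : b * a * b = b.
Proof. by have [_ b2a _] := ab; rewrite -mulrA -drazin_comm mulrA -expr2. Qed.

Lemma drazin_proj_idem : b * a * (b * a) = b * a.
Proof. by rewrite mulrA drazin_mulK. Qed.

Lemma drazin_proj_comm : GRing.comm (b * a) a.
Proof. by rewrite /GRing.comm {1}drazin_comm -mulrA. Qed.

Lemma drazin_projX {n} : (0 < n)%N -> b ^+ n * a ^+ n = b * a.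
Proof.
case: n => // n _; rewrite -exprMn_comm; last exact: drazin_comm.
by elim: n => // n IHn; rewrite exprS IHn drazin_proj_idem.
Qed.

Lemma drazin_proj_mulX {n} : (0 < n)%N -> b * a * b ^+ n = b ^+ n.
Proof. by case: n => // n _; rewrite exprS mulrA drazin_mulK. Qed.

Lemma drazin_mulX_proj {n} : (0 < n)%N -> b ^+ n * (b * a) = b ^+ n.
Proof.
case: n => // n _.
by rewrite exprSr -mulrA drazin_comm (mulrA b) drazin_mulK.
Qed.

Lemma drazin_mul_proj_ge :
  exists2 p, (0 < p)%N & forall n, (p <= n)%N -> a ^+ n * (b * a) = a ^+ n.
Proof.
have [_ _ [p p_gt0 ap]] := ab; exists p => // n /subnK <-.
by rewrite exprD -mulrA drazin_comm (mulrA (a ^+ p)) -exprSr ap.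
Qed.

End DrazinProjection.

Section AdjointTheory.
Context {R : realType} {H : hilbertType R}.
Implicit Types S T P : boundedOp H.

Lemma adjointK : involutive (@adjoint R H).
Proof.
move=> T; apply/esym/adjoint_unique => x y.
by rewrite innerC -adjointE -innerC.
Qed.

Lemma adjointM S T : adjoint (S * T) = adjoint T * adjoint S.
Proof.
by apply/esym/adjoint_unique => x y; rewrite !bopME !adjointE.
Qed.

Lemma adjoint1 : adjoint (1 : boundedOp H) = 1.
Proof. by apply/esym/adjoint_unique. Qed.

Lemma adjointX T n : adjoint (T ^+ n) = adjoint T ^+ n.
Proof.
elim: n => [|n IHn]; first by rewrite !expr0 adjoint1.
by rewrite exprSr adjointM IHn -exprS.
Qed.

Lemma adjoint_mul_eq0 T : adjoint T * T = 0 -> T = 0.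
Proof.
move=> TT0; apply: bopP => x; rewrite bop0E.
apply/eqP; rewrite -normr_eq0 -sqrf_eq0 sqr_norm_inner adjointE.
by rewrite -bopME TT0 bop0E linear0r.
Qed.

(** [adjoint S * S = adjoint S * (adjoint P * S) = 0]. For idempotent [P], this means that the range
    of [P] meets the kernel of [adjoint P] trivially. *)
Lemma adjoint_proj_inj P S : P * S = S -> adjoint P * S = 0 -> S = 0.
Proof.
move=> PS P'S; apply: adjoint_mul_eq0.
by rewrite -{1}PS adjointM -mulrA P'S mulr0.
Qed.

Lemma drazin_proj_selfadjoint {T D : boundedOp H} {m} (P := D * T) :
    is_drazin_inverse T D -> (0 < m)%N ->
    P * (adjoint T ^+ m * P) = adjoint T ^+ m * P ->
  adjoint P = P.
Proof.
move=> TD m0 inv; have [p p0 TP] := drazin_mul_proj_ge TD.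
(* That is, [T ^+ m] preserves the kernel of [adjoint P], which is the range of [1 - adjoint P]. *)
have inv' : adjoint P * T ^+ m * adjoint P = adjoint P * T ^+ m.
  have := congr1 (@adjoint R H) inv.
  by rewrite !adjointM adjointX adjointK.
have invX k : adjoint P * T ^+ (m * k) * adjoint P
    = adjoint P * T ^+ (m * k).
  elim: k => [|k IHk].
    by rewrite muln0 expr0 mulr1 -adjointM drazin_proj_idem.
  by rewrite mulnS addnC exprD mulrA -IHk -!mulrA (mulrA _ (T ^+ m)) inv'.
(* The exponent [m * p] is a multiple of [m], for [invX], and at least [p], for [TP]. *)
have mp0 : (0 < m * p)%N by rewrite muln_gt0 m0.
have PTmp : P * T ^+ (m * p) = T ^+ (m * p).
  by rewrite (commrX _ (drazin_proj_comm TD)) TP// leq_pmull.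
have TmpP' : T ^+ (m * p) * (1 - adjoint P) = 0.
  apply: (@adjoint_proj_inj P); first by rewrite mulrA PTmp.
  by rewrite !mulrA mulrBr mulr1 invX subrr.
have PP' : P = P * adjoint P.
  apply/subr0_eq; rewrite -{1}[P]mulr1 -mulrBr.
  by rewrite -[P in P * _](drazin_projX TD mp0) -mulrA TmpP' mulr0.
by rewrite [in LHS]PP' adjointM adjointK -PP'.
Qed.

End AdjointTheory.

Theorem proposition2p3 (R : realType) (H : hilbertType R) (n m : nat)
    (T : boundedOp H) :
  infinite_dimensional H -> (1 <= n)%N -> (1 <= m)%N -> drazin_invertible T ->
  (DQN n m T <-> DN n m T).
Proof.
move=> _ n0 m0 /drazinP; rewrite /DQN /DN /commutator.
move: (drazin T) => D TD; set B := adjoint T ^+ m.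
have DnT : D ^+ n * T = T * D ^+ n.
  exact/commr_sym/commrX/commr_sym/(drazin_comm TD).
split=> [/subr0_eq DQ|/subr0_eq DB]; last first.
  by rewrite mulrA DB -!mulrA DnT subrr.
pose P := D * T.
have TDP : T * D = P by rewrite /P (drazin_comm TD).
(* Writing [P] as [T * D] supplies the factor [T] that [DQ] needs after [B]. *)
have comm_on_P : D ^+ n * B * P = B * D ^+ n.
  rewrite -TDP mulrA -(mulrA _ B) DQ -!mulrA (mulrA T) -DnT -!mulrA TDP.
  by rewrite (drazin_mulX_proj TD n0).
(* A factor [D ^+ n] on the left puts the range of [B * P] inside that of [P]. *)
have BP : P * (B * P) = B * P.
  have -> : B * P = D ^+ n * B * P * T ^+ n.
    by rewrite comm_on_P -mulrA (drazin_projX TD n0).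
  by rewrite !mulrA (drazin_proj_mulX TD n0).
have P' : adjoint P = P := drazin_proj_selfadjoint TD m0 BP.
have PT : P * T = T * P := drazin_proj_comm TD.
(* By [P'], the adjoint of [PT] says that [P] commutes with [adjoint T]. *)
have PB : P * B = B * P.
  by apply: commrX; rewrite /GRing.comm -P' -!adjointM PT.
by rewrite -comm_on_P -mulrA -PB mulrA (drazin_mulX_proj TD n0) subrr.
Qed.
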